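(* Let $0<\epsilon<1/2$, let $\gamma$ be a real number, let $y_0\in\mathbb{R}^d$, and let $0=\tau_0<\tau_1<\dots<\tau_N=T$ be a partition of $[0,T]$ consisting of $[0,T]$-valued random variables, with $h:=\max_{k=0,\dots,N-1}|\tau_{k+1}-\tau_k|$. Suppose: (i) for a random variable $L_{\mathrm{SDE}}>0$, $\|y(t;s,z^1)-y(t;s,z^2)\|\le L_{\mathrm{SDE}}\|z^1-z^2\|$ for all $0\le s\le t\le T$ and $z^1,z^2\in\mathbb{R}^d$; (ii) for a random variable $K_{\mathrm{SDE}}>0$, $\|(y(t;s,z^1)-z^1)-(y(t;s,z^2)-z^2)\|\le K_{\mathrm{SDE}}(t-s)^{1/2-\epsilon/3}\|z^1-z^2\|$ for all $0\le s<t\le T$ and $z^1,z^2\in\mathbb{R}^d$; (iii) for a random variable $K_{\mathrm{TES}}>0$, the one-step method satisfies $$\Big\|\sum_{j=k}^{n-1}\delta(\tau_j,\tau_{j+1},y_j)\Big\|\le K_{\mathrm{TES}}(\tau_n-\tau_k)^{(1+\epsilon)/2}h^{\gamma-\epsilon},\qquad 0\le k<n\le N,$$ where $y_j=S_{0j}(y_0)$. Then $$\max_{n=0,\dots,N}\|S_{0n}(y_0)-y(\tau_n;0,y_0)\|\le K_{\mathrm{TES}}\,L_{\mathrm{SDE}}(\epsilon,T)\,h^{\gamma-\epsilon},$$ where $$L_{\mathrm{SDE}}(\epsilon,T):=T^{(1+\epsilon)/2}+\frac{2K_{\mathrm{SDE}}(L_{\mathrm{SDE}}+2)}{1-2^{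-\epsilon/6}}\left(T^{1+\epsilon/6}+\frac{T^{2+\epsilon/6}\,(K_{\mathrm{SDE}}(L_{\mathrm{SDE}}+1))^{2/(1-2\epsilon)}}{(2^{\epsilon/6}-1)^{2/(1-2\epsilon)}}\right).$$
   Context: Let $(\Omega,\mathcal{F},\mathcal{F}_t,\mathbb{P})$ be a filtered probability space with independent $\mathcal{F}_t$-Brownian motions $W^1,\dots,W^m$, and let $T>0$. Consider the Itô SDE in $\mathbb{R}^d$ $$dy(t)=g_0(y(t))\,dt+\sum_{j=1}^m g_j(y(t))\,dW^j(t),$$ with $g_j:\mathbb{R}^d\to\mathbb{R}^d$ sufficiently regular that solutions exist on $[0,T]$ and are pathwise unique for a given initial condition. $y(t;s,z)$ denotes the solution for $t\in[s,T]$ with $y(s)=z$; it is regarded pathwise as a function of $(t,s,z)$ and may be evaluated at random arguments. A one-step method $S_{n,n+1}$ (for the step from $\tau_n$ to $\tau_{n+1}$) is a map from $\mathbb{R}^d$ to the set of $\mathbb{R}^d$-valued random variables; $S_{kn}(z)$ denotes the composition $S_{n-1,n}\circ\dots\circ S_{k,k+1}(z)$ for $k<n$, and $S_{kk}(z)=z$. The local truncation error is $\delta(\tau_n,\tau_{n+1},z):=y(\tau_{n+1};\tau_n,z)-S_{n,n+1}(z)$. Assumptions and conclusion are understood pathwise (almost surely). *)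

(* Defs.v *)
From HB Require Import structures.
From mathcomp Require Import all_boot all_order all_algebra.
From mathcomp Require Import all_classical all_reals all_analysis.

Set Implicit Arguments.
Unset Strict Implicit.
Unset Printing Implicit Defensive.

Import Order.TTheory GRing.Theory Num.Theory.
Import numFieldNormedType.Exports.

Local Open Scope classical_set_scope.
Local Open Scope ring_scope.

(* The norm carried by 'rV[R]_d in the library is the sup norm; this is the
   Euclidean one. *)
Definition enorm (R : realType) (d : nat) (x : 'rV[R]_d) : R :=
  Num.sqrt (\sum_(i < d) x 0 i ^+ 2).

Definition borel_fun (R : realType) (d : nat) (g : 'rV[R]_d -> 'rV[R]_d) : Prop :=
  forall (i : 'I_d) (B : set R), measurable B ->
    <<s [set U : set 'rV[R]_d | open U] >> [set x | B (g x 0 i)].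

Section SDE.
Context (R : realType) (disp : measure_display) (Omega : measurableType disp).
Variable P : probability Omega R.

Definition filtration (T : R) (F : R -> set (set Omega)) : Prop :=
  (forall t, 0 <= t <= T ->
     sigma_algebra setT (F t) /\ F t `<=` @measurable _ Omega) /\
  (forall s t, 0 <= s -> s <= t -> t <= T -> F s `<=` F t).

Definition measurable_wrt (G : set (set Omega)) (X : Omega -> R) : Prop :=
  forall B : set R, measurable B -> G (X @^-1` B).

Definition vmeasurable_wrt (d : nat) (G : set (set Omega))
    (X : Omega -> 'rV[R]_d) : Prop :=
  forall i, measurable_wrt G (fun w => X w 0 i).

Definition increment (W : R -> Omega -> R) (s t : R) (w : Omega) : R := W t w - W s w.

Definition brownian (T : R) (F : R -> set (set Omega)) (W : R -> Omega -> R) : Prop :=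
  [/\ {ae P, forall w, W 0 w = 0},
      {ae P, forall w, {within `[0, T], continuous (fun t => W t w)}},
      (forall t, 0 <= t <= T -> measurable_wrt (F t) (W t)),
      (forall s t (B : set R), 0 <= s -> s < t -> t <= T -> measurable B ->
         P (increment W s t @^-1` B)
         = normal_prob 0 (Num.sqrt (t - s)) B) &
      (forall s t (A : set Omega) (B : set R), 0 <= s -> s < t -> t <= T ->
         F s A -> measurable B ->
         P (A `&` increment W s t @^-1` B)
         = (P A * P (increment W s t @^-1` B))%E)].

Definition process_sigma (T : R) (W : R -> Omega -> R) : set (set Omega) :=
  <<s [set A | exists t (B : set R),
         [/\ 0 <= t <= T, measurable B & A = W t @^-1` B]] >>.

(* Every subfamily is covered, since E j = setT is allowed. *)
Definition independent_processes (T : R) (m : nat) (W : 'I_m -> R -> Omega -> R) : Prop :=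
  forall E : 'I_m -> set Omega, (forall j, process_sigma T (W j) (E j)) ->
    fine (P (\bigcap_(j in [set: 'I_m]) E j)) = \prod_(j < m) fine (P (E j)).

(* Convergence to 0 in probability; the measurable supersets avoid having to
   know that the Z n are measurable. *)
Definition cvg0_in_prob (Z : nat -> Omega -> \bar R) : Prop :=
  forall e : R, 0 < e -> exists A : nat -> set Omega,
    [/\ forall n, measurable (A n),
        forall n, [set w | (e%:E <= Z n w)%E] `<=` A n &
        (fun n => P (A n)) @ \oo --> 0%E].

(* The process sum_(i < simple_size) simple_val i * 1_]t_i, t_{i+1}] with
   t_i = simple_time i. *)
Record simple_process := SimpleProcess {
  simple_size : nat;
  simple_time : nat -> R;
  simple_val : nat -> Omega -> R }.

Definition simple_on (F : R -> set (set Omega)) (a b : R) (H : simple_process) : Prop :=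
  [/\ simple_time H 0%N = a,
      simple_time H (simple_size H) = b,
      (forall i, (i < simple_size H)%N -> simple_time H i <= simple_time H i.+1) &
      (forall i, (i < simple_size H)%N ->
         measurable_wrt (F (simple_time H i)) (simple_val H i) /\
         exists M : R, forall w, `|simple_val H i w| <= M)].

Definition simple_eval (H : simple_process) (u : R) (w : Omega) : R :=
  \sum_(i < simple_size H)
    simple_val H i w * \1_(`]simple_time H i, simple_time H i.+1]) u.

Definition simple_integral (H : simple_process) (W : R -> Omega -> R) (w : Omega) : R :=
  \sum_(i < simple_size H)
    simple_val H i w * (W (simple_time H i.+1) w - W (simple_time H i) w).

(* I is (a version of) the Ito integral of X against W over [a, b]. *)
Definition ito_integral (F : R -> set (set Omega)) (W X : R -> Omega -> R)
    (a b : R) (I : Omega -> R) : Prop :=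
  exists H : nat -> simple_process,
    [/\ forall n, simple_on F a b (H n),
        cvg0_in_prob (fun n w =>
          \int[lebesgue_measure]_(u in `[a, b])
             ((simple_eval (H n) u w - X u w) ^+ 2)%:E)%E &
        cvg0_in_prob (fun n w => (`|simple_integral (H n) W w - I w|)%:E)].

(* X solves dX = g0(X) dt + sum_j g j(X) dW^j on [s, T]; the equation is
   required on every subinterval [r, t] of [s, T]. *)
Definition sde_solution (T : R) (F : R -> set (set Omega)) (m d : nat)
    (W : 'I_m -> R -> Omega -> R)
    (g0 : 'rV[R]_d -> 'rV[R]_d) (g : 'I_m -> 'rV[R]_d -> 'rV[R]_d)
    (s : R) (X : R -> Omega -> 'rV[R]_d) : Prop :=
  [/\ forall t, s <= t <= T -> vmeasurable_wrt (F t) (X t),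
      {ae P, forall w, {within `[s, T], continuous (fun t => X t w)}},
      {ae P, forall w, forall i : 'I_d, lebesgue_measure.-integrable `[s, T]
               (fun u => (g0 (X u w) 0 i)%:E)} &
      forall (r t : R) (i : 'I_d), s <= r -> r <= t -> t <= T ->
        exists I : 'I_m -> Omega -> R,
          (forall j, ito_integral F (W j) (fun u w => g j (X u w) 0 i) r t (I j)) /\
          {ae P, forall w,
             X t w 0 i = X r w 0 i
               + \int[lebesgue_measure]_(u in `[r, t]) g0 (X u w) 0 i
               + \sum_(j < m) I j w}].

Definition pathwise_unique (T : R) (F : R -> set (set Omega)) (m d : nat)
    (W : 'I_m -> R -> Omega -> R)
    (g0 : 'rV[R]_d -> 'rV[R]_d) (g : 'I_m -> 'rV[R]_d -> 'rV[R]_d) : Prop :=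
  forall (s : R) (X X' : R -> Omega -> 'rV[R]_d), 0 <= s <= T ->
    sde_solution T F W g0 g s X -> sde_solution T F W g0 g s X' ->
    {ae P, forall w, X s w = X' s w} ->
    {ae P, forall w, forall t, s <= t <= T -> X t w = X' t w}.

(* y w t s z stands for y(t;s,z).  For each fixed (s, z) the SDE determines
   y(.;s,z) only up to a null set depending on (s, z), so reading y pathwise as
   a function of (t, s, z) means choosing a version: the jointly continuous one.
   The initial value may be any random variable known at time s. *)
Definition solution_map (T : R) (F : R -> set (set Omega)) (m d : nat)
    (W : 'I_m -> R -> Omega -> R)
    (g0 : 'rV[R]_d -> 'rV[R]_d) (g : 'I_m -> 'rV[R]_d -> 'rV[R]_d)
    (y : Omega -> R -> R -> 'rV[R]_d -> 'rV[R]_d) : Prop :=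
  (forall (s : R) (Z : Omega -> 'rV[R]_d), 0 <= s <= T ->
     vmeasurable_wrt (F s) Z ->
     sde_solution T F W g0 g s (fun t w => y w t s (Z w)) /\
     {ae P, forall w, y w s s (Z w) = Z w}) /\
  {ae P, forall w,
     {within [set p : R * R * 'rV[R]_d | 0 <= p.1.2 /\ p.1.2 <= p.1.1 /\ p.1.1 <= T],
        continuous (fun p : R * R * 'rV[R]_d => y w p.1.1 p.1.2 p.2)}}.

Definition random_partition (T : R) (N : nat) (tau : nat -> Omega -> R) : Prop :=
  {ae P, forall w,
     [/\ tau 0%N w = 0, tau N w = T,
         (forall k, (k < N)%N -> tau k w < tau k.+1 w) &
         (forall k, (k <= N)%N -> 0 <= tau k w <= T)]}.

End SDE.

Definition mesh (R : realType) (Omega : Type) (N : nat) (tau : nat -> Omega -> R)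
    (w : Omega) : R :=
  \big[Num.max/0]_(k < N) `|tau k.+1 w - tau k w|.

(* S n z is the random variable S_{n,n+1}(z); the composition is taken pathwise:
   compose_steps S k n z = S_{kn}(z). *)
Definition compose_steps (Omega V : Type) (S : nat -> V -> Omega -> V)
    (k n : nat) (z : V) (w : Omega) : V :=
  foldl (fun x j => S j x w) z (index_iota k n).

Definition local_error (R : realType) (Omega : Type) (d : nat)
    (y : Omega -> R -> R -> 'rV[R]_d -> 'rV[R]_d)
    (S : nat -> 'rV[R]_d -> Omega -> 'rV[R]_d)
    (tau : nat -> Omega -> R) (n : nat) (z : 'rV[R]_d) (w : Omega) : 'rV[R]_d :=
  y w (tau n.+1 w) (tau n w) z - S n z w.

(* L_SDE(eps, T) as a function of the values of the constants L_SDE, K_SDE. *)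
Definition LSDE_const (R : realType) (eps T L K : R) : R :=
  T `^ ((1 + eps) / 2)
  + (2 * K * (L + 2)) / (1 - 2 `^ (- (eps / 6)))
    * (T `^ (1 + eps / 6)
       + T `^ (2 + eps / 6) * (K * (L + 1)) `^ (2 / (1 - 2 * eps))
         / (2 `^ (eps / 6) - 1) `^ (2 / (1 - 2 * eps))).

(* Main.v *)
Require Import Defs.
From HB Require Import structures.
From mathcomp Require Import all_boot all_order all_algebra.
From mathcomp Require Import all_classical all_reals all_analysis.
From mathcomp Require Import ring lra.

Import Order.TTheory GRing.Theory Num.Theory.
Import numFieldNormedType.Exports.

Local Open Scope classical_set_scope.
Local Open Scope ring_scope.

(** Outside a null set the statement is a deterministic one about the flow y and
the numerical values y_j = S_{0j}(y_0). Write al = 1/2 - eps/3, be = (1+eps)/2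
and th = eps/6, so that al + be = 1 + th exceeds 1: this is what a sewing argument
needs. Put K = K_SDE, L = L_SDE, A = K_TES h^(gamma-eps) and
kap = K / (2^th - 1).

The error of restarting at step j, E_{jk} = y(tau_k; tau_j, y_j) - y_k, is almost
additive: by the flow property ([err_split]) E_{jk} = E_{jm} + E_{mk} + rho with
|rho| <= K (tau_k - tau_m)^al |E_{jm}|. Subtracting the additive sum of the local
errors, which is at most A (tau_k - tau_j)^be by hypothesis, leaves a remainder
that is bounded by halving intervals ([sewing]): it is at most
A kap l^(1+th) on every interval of length l with kap l^al <= 2. Since the
partition is irregular, an interval is cut at the two ends of the step that
contains its midpoint; the numerical inequality behind the induction is
[sewing_step].

A longer interval is exhausted greedily by blocks on which kap l^al has just
exceeded 2 ([err_le]). The flow from the end of a block to the final time expands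
the error of the block by at most L, and on a block l^be is at most
kap l^(1+th) / 2, so a block of length l contributes at most
2 A L kap T^th l. These bounds are linear in l and add up to
2 A L kap T^(1+th), which the constant L_SDE(eps,T) dominates
([LSDE_const_ge]).

The flow property y(t;s,y(s;r,z)) = y(t;r,z) must hold at the random times tau_j
and points y_j. Pathwise uniqueness gives it almost surely for fixed r, s, z,
hence simultaneously for the countably many grid values of (r, s, z), and the
joint continuity of y extends it to all of them ([flow_ae]). *)

Set Implicit Arguments.
Unset Strict Implicit.

(** * Real powers *)

Section Powers.
Context {R : realType}.
Implicit Types x y u p r th : R.

Lemma powR_mono x y p : 0 <= p -> 0 <= x -> x <= y -> x `^ p <= y `^ p.
Proof.
move=> p0 x0 xy; apply: ge0_ler_powR => //; rewrite nnegrE //.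
exact: le_trans xy.
Qed.

Lemma powR_le1 x p : 0 <= p -> 0 <= x -> x <= 1 -> x `^ p <= 1.
Proof. by move=> p0 x0 x1; rewrite (le_trans (powR_mono p0 x0 x1)) ?powR1. Qed.

Lemma powR_add x p r : 0 < p -> 0 < r -> x `^ (p + r) = x `^ p * x `^ r.
Proof. by move=> p0 r0; rewrite powRD // gt_eqF // addr_gt0. Qed.

(** The constant 3/50 comes from 1.06^12 > 2. *)
Lemma pow2_gap th : 0 < th -> th * 12 <= 1 ->
  0 < 2 `^ th - 1 /\ 2 `^ th - 1 <= 3 / 50.
Proof.
move=> th0 th12.
have p1 : 1 < 2 `^ th.
  rewrite -[ltLHS](powRr0 2) /powR pnatr_eq0 /= mul0r ltr_expR.
  by rewrite mulr_gt0 // ln_gt0 // ltr1n.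
split; first by rewrite subr_gt0.
have : (2 `^ th) ^+ 12 <= (53 / 50) ^+ 12.
  rewrite -powR_mulrn ?powR_ge0 // -powRrM.
  apply: (@le_trans _ _ (2 : R)); last by rewrite !exprS expr0; lra.
  by rewrite ler1_powR // ler1n.
have p53 : 2 `^ th \is Num.nneg by rewrite nnegrE powR_ge0.
have h53 : 53 / 50 \is @Num.nneg R by rewrite nnegrE; lra.
by rewrite (ler_pXn2r _ p53 h53) // lerBlDl => /le_trans -> //; lra.
Qed.

Lemma powR_half p : (1 / 2) `^ p = (2 `^ p)^-1 :> R.
Proof. by rewrite div1r -powR_inv1 // -powRrM mulN1r powRN. Qed.

Lemma powR_half_mono u p : 0 <= p -> 0 <= u -> u <= 1 / 2 -> u `^ p <= (2 `^ p)^-1.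
Proof. by move=> p0 u0 u2; rewrite -powR_half powR_mono. Qed.
End Powers.

(** * The inequality behind the halving argument *)

Section SewingStep.
Context {R : realType}.
Implicit Types (eps : R).

Local Notation al eps := (1 / 2 - eps / 3).
Local Notation be eps := ((1 + eps) / 2).
Local Notation th eps := (eps / 6).

(** An interval of length 1 is cut into pieces of lengths u, s, v in this order.
Let q = 2^th - 1. Since u and v are at most 1/2, the sum of the powers 1 + th is
at most (1 - s) / (1 + q), so the cut gains 2/3 (q + s) / (1 + q). The cross term
of u is at most 1/2 q / (1 + q), which leaves (q/6 + 2s/3) / (1 + q); that of the
middle piece is at most q sqrt s, and q (1 + q) sqrt s <= q/6 + 2s/3 because q is
small. *)
Lemma split_gain eps (u v s : R) : 0 < eps < 1 / 2 ->
  0 <= u <= 1 / 2 -> 0 <= v <= 1 / 2 -> 0 <= s -> u + v + s = 1 ->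
  2 / 3 * (u `^ (1 + th eps) + v `^ (1 + th eps))
    + (2 `^ th eps - 1)
      * ((v + s) `^ al eps * u `^ be eps + v `^ al eps * s `^ be eps) <= 2 / 3.
Proof.
move=> /andP[eps0 eps2].
set al := al eps; set be := be eps; set th := th eps.
have [th0 th12] : 0 < th /\ th * 12 <= 1 by rewrite /th; split; lra.
have [al0 al2] : 0 < al /\ al <= 1 / 2 by rewrite /al; split; lra.
have [al_be be2] : al < be /\ 1 / 2 < be by rewrite /al /be; split; lra.
have albe : al + be = 1 + th by rewrite /al /be /th; lra.
move: al be th th0 th12 al0 al2 al_be be2 albe.
move=> al be th th0 th12 al0 al2 al_be be2 albe {eps eps0 eps2}.
move=> /andP[u0 u2] /andP[v0 v2] s0 e.
have [] := pow2_gap th0 th12.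
have : 2 `^ th = 1 + (2 `^ th - 1) :> R by rewrite subrKC.
move: (X in 1 + X) => q pE; rewrite [X in X - 1]pE addrC addKr => q0 q1.
have X (x : R) : 0 <= x -> x <= 1 / 2 -> x `^ (1 + th) <= x / (1 + q).
  move=> x0 x2; rewrite powR_add ?ltr01 // powRr1 // ler_wpM2l // -pE.
  by rewrite powR_half_mono // ltW.
have [al0w be0] : 0 <= al /\ 0 <= be by split; lra.
(* u^be is split as u^al u^(be - al): then (v+s) u <= 1/4 and u <= 1/2. *)
have H1 : (v + s) `^ al * u `^ be <= 1 / 2 / (1 + q).
  have -> : be = al + (be - al) by ring.
  rewrite powR_add ?subr_gt0 //.
  rewrite mulrA -powRM ?addr_ge0 //.
  have -> : 1 / 2 / (1 + q) = (1 / 2 * (1 / 2)) `^ al * (1 / 2) `^ (be - al).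
    have h0 : 0 <= 1 / 2 :> R by lra.
    rewrite powRM // -[RHS]mulrA -(@powR_add _ _ al (be - al)) ?subr_gt0 //.
    rewrite subrKC -powR_add //; last by lra.
    by rewrite albe powR_add // ?ltr01 // powRr1 // [in RHS]powR_half pE.
  apply: ler_pM; rewrite ?powR_ge0 ?powR_mono ?subr_ge0 ?(ltW al_be) ?mulr_ge0 ?addr_ge0 //.
  have -> : v + s = 1 - u by lra.
  nra.
have [x x0 sx] : exists2 x, 0 <= x & s = x ^+ 2.
  by exists (Num.sqrt s); rewrite ?sqrtr_ge0 // sqr_sqrtr.
have s1 : s <= 1 by lra.
have H2 : v `^ al * s `^ be <= x.
  rewrite -[leRHS]mul1r ler_pM ?powR_ge0 ?powR_le1 //; first by lra.
  have -> : be = 1 / 2 + (be - 1 / 2) by ring.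
  rewrite powR_add; [|lra|by rewrite subr_gt0].
  rewrite div1r powR12_sqrt // sx sqrtr_sqr ger0_norm // ler_piMr // -sx.
  by rewrite powR_le1 // subr_ge0; lra.
have Xu := X _ u0 u2; have Xv := X _ v0 v2.
have uv : u / (1 + q) + v / (1 + q) = (1 - s) / (1 + q).
  by rewrite -mulrDl; congr (_ / _); lra.
apply: (@le_trans _ _ (2 / 3 * ((1 - s) / (1 + q)) + q * (1 / 2 / (1 + q) + x))).
  by rewrite lerD // ler_pM2l //; lra.
have qn0 : 1 + q != 0 by rewrite gt_eqF //; lra.
rewrite -subr_ge0.
have -> : 2 / 3 - (2 / 3 * ((1 - s) / (1 + q)) + q * (1 / 2 / (1 + q) + x))
  = (1 + q)^-1 * (q / 6 + 2 / 3 * s - q * x * (1 + q)) by field.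
rewrite sx; apply: mulr_ge0; first by rewrite invr_ge0; lra.
have qx : 0 <= q * x * (3 / 50 - q) by rewrite !mulr_ge0 ?subr_ge0 // ltW.
have qq : 0 <= q * (3 / 50 - q) by rewrite mulr_ge0 ?subr_ge0 // ltW.
(* 795/1000 = 3/4 * 53/50 completes the square of 2/3 x^2 - 53/50 q x. *)
have := sqr_ge0 (x - 795 / 1000 * q).
nra.
Qed.

Lemma split_gain_scaled eps (a b s : R) : 0 < eps < 1 / 2 ->
  0 <= a -> 0 <= b -> 0 <= s -> 0 < a + b + s ->
  a <= (a + b + s) / 2 -> b <= (a + b + s) / 2 ->
  2 / 3 * (a `^ (1 + th eps) + b `^ (1 + th eps))
    + (2 `^ th eps - 1)
      * ((b + s) `^ al eps * a `^ be eps + b `^ al eps * s `^ be eps)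
  <= 2 / 3 * (a + b + s) `^ (1 + th eps).
Proof.
move=> heps a0 b0 s0; set l := a + b + s => l0 al2 bl2.
have div0 (x : R) : 0 <= x -> 0 <= x / l by move=> x0; rewrite divr_ge0 // ltW.
have scale (x p : R) : 0 <= x -> x `^ p = (x / l) `^ p * l `^ p.
  by move=> x0; rewrite -powRM ?div0 ?(ltW l0) // divfK // gt_eqF.
have lX : l `^ (1 + th eps) = l `^ al eps * l `^ be eps.
  have /andP[? ?] := heps.
  by rewrite -powR_add; [congr (_ `^ _); lra|lra|lra].
have half (x : R) : 0 <= x -> x <= l / 2 -> 0 <= x / l <= 1 / 2.
  by move=> x0 x2; rewrite div0 //= ler_pdivrMr // mulrAC mul1r mulrC mulrC.
have := split_gain heps (half _ a0 al2) (half _ b0 bl2) (div0 _ s0).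
rewrite -!mulrDl divff ?gt_eqF // => /(_ erefl) /(ler_wpM2r (powR_ge0 l (1 + th eps))).
rewrite (scale a) // (scale b) // (scale a) // (scale b) // (scale s) //.
rewrite (scale (b + s)) ?addr_ge0 //.
apply: le_trans; rewrite lX le_eqVlt; apply/orP; left; apply/eqP; ring.
Qed.

(** Both terms are kept in the induction on intervals: the second absorbs the
cross term between the increments of the flow and the remainder itself, which
is smaller by a factor kap l^al. *)
Definition sewing_bound eps kap l : R :=
  kap * (2 / 3 * l `^ (1 + th eps) + kap / 6 * l `^ (1 + th eps + al eps)).

Lemma sewing_bound_ge0 eps kap l : 0 <= kap -> 0 <= sewing_bound eps kap l.
Proof.
by move=> k0; rewrite mulr_ge0 // addr_ge0 // mulr_ge0 ?powR_ge0 ?divr_ge0.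
Qed.

(** The threshold 2 is chosen so that 2/3 + 2/6 = 1. *)
Lemma sewing_bound_le eps kap l : 0 < eps < 1 / 2 -> 0 <= kap ->
  kap * l `^ al eps <= 2 -> sewing_bound eps kap l <= kap * l `^ (1 + th eps).
Proof.
move=> /andP[eps0 eps2] k0 kl; rewrite ler_wpM2l //.
rewrite (@powR_add _ l (1 + _)); [|lra|lra].
have := ler_wpM2r (powR_ge0 l (1 + th eps)) kl.
lra.
Qed.

(** The terms of order 1 + th are [split_gain]. In those of order 1 + th + al,
two halves lose the factor 2 * 2^-(4/3) < 4/5, since al > 1/3, and the remaining
fifth exceeds the cross term because 2^th - 1 <= 3/50 and kap l^al <= 2. *)
Lemma sewing_step eps kap (a b s : R) : 0 < eps < 1 / 2 -> 0 <= kap ->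
  0 <= a -> 0 <= b -> 0 <= s -> 0 < a + b + s ->
  a <= (a + b + s) / 2 -> b <= (a + b + s) / 2 ->
  kap * (a + b + s) `^ al eps <= 2 ->
  sewing_bound eps kap a + sewing_bound eps kap b
    + kap * (2 `^ th eps - 1)
      * ((b + s) `^ al eps * (a `^ be eps + sewing_bound eps kap a)
         + b `^ al eps * s `^ be eps)
  <= sewing_bound eps kap (a + b + s).
Proof.
move=> heps k0 a0 b0 s0 l0 al2 bl2 kl.
have first := split_gain_scaled heps a0 b0 s0 l0 al2 bl2.
have second : 1 / 6 * (a `^ (1 + th eps + al eps) + b `^ (1 + th eps + al eps))
    + (2 `^ th eps - 1) * (b + s) `^ al eps
      * (2 / 3 * a `^ (1 + th eps) + kap / 6 * a `^ (1 + th eps + al eps))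
  <= 1 / 6 * (a + b + s) `^ (1 + th eps + al eps).
  move: l0 al2 bl2 kl; have : b + s <= a + b + s by lra.
  move: (a + b + s) => l bsl l0 al2 bl2 kl {first}.
  have /andP[eps0 eps2] := heps.
  have [q0 q1] : 0 < 2 `^ th eps - 1 :> R /\ 2 `^ th eps - 1 <= 3 / 50 :> R.
    by apply: pow2_gap; lra.
  have p43 : (2 `^ (4 / 3))^-1 <= 2 / 5 :> R.
    have h : 5 / 2 <= 2 `^ (4 / 3) :> R.
      have p2 : 2 `^ (4 / 3) \is @Num.nneg R by rewrite nnegrE powR_ge0.
      have h52 : 5 / 2 \is @Num.nneg R by rewrite nnegrE; lra.
      rewrite -(@ler_pXn2r R 3 _ _ _ h52 p2) //.
      rewrite -[leRHS]powR_mulrn ?powR_ge0 // -powRrM.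
      have -> : 4 / 3 * 3%:R = 4%:R :> R by lra.
      by rewrite powR_mulrn // !exprS expr0; lra.
    by rewrite -[leRHS]invrK lef_pV2 ?posrE ?powR_gt0 //; lra.
  have sm (x p r : R) : 0 <= r -> r <= p -> 0 <= x -> x <= l / 2 ->
      x `^ p <= (2 `^ r)^-1 * l `^ p.
    move=> r0 rp x0 x2.
    apply: (@le_trans _ _ ((1 / 2 * l) `^ p)).
      by rewrite powR_mono //; lra.
    rewrite powRM; [|lra|exact: ltW].
    rewrite powR_half ler_wpM2r ?powR_ge0 // lef_pV2 ?posrE ?powR_gt0 //.
    by rewrite ler_powR // ler1n.
  have A1 : a `^ (1 + th eps) <= 1 / 2 * l `^ (1 + th eps).
    by rewrite -[1 / 2](powRr1) // powR_half sm //; lra.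
  have A2 (x : R) : 0 <= x -> x <= l / 2 ->
      x `^ (1 + th eps + al eps) <= 2 / 5 * l `^ (1 + th eps + al eps).
    move=> x0 x2; apply: (@le_trans _ _ ((2 `^ (4 / 3))^-1 * l `^ (1 + th eps + al eps))).
      by apply: sm => //; lra.
    by rewrite ler_wpM2r ?powR_ge0.
  have bs : (b + s) `^ al eps <= l `^ al eps.
    by apply: powR_mono => //; [lra|exact: addr_ge0].
  have lE : l `^ (1 + th eps + al eps) = l `^ al eps * l `^ (1 + th eps).
    by rewrite powR_add; [rewrite mulrC|lra|lra].
  have aE : kap * a `^ (1 + th eps + al eps) <= 2 * a `^ (1 + th eps).
    rewrite powR_add; [|lra|lra].
    rewrite mulrCA mulrC ler_wpM2r ?powR_ge0 //.
    rewrite (le_trans _ kl) // ler_wpM2l // powR_mono //; lra.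
  have T : (2 `^ th eps - 1) * (b + s) `^ al eps
      * (2 / 3 * a `^ (1 + th eps) + kap / 6 * a `^ (1 + th eps + al eps))
      <= 3 / 50 * l `^ al eps * (1 / 2 * l `^ (1 + th eps)).
    apply: ler_pM.
    - by rewrite mulr_ge0 ?powR_ge0 // ltW.
    - by rewrite addr_ge0 // mulr_ge0 ?powR_ge0 ?divr_ge0.
    - by apply: ler_pM; rewrite ?powR_ge0 // ltW.
    - by move: A1 aE; lra.
  have B1 := A2 a a0 al2; have B2 := A2 b b0 bl2.
  have L0 := powR_ge0 l (1 + th eps + al eps).
  by move: T B1 B2 L0; rewrite lE; lra.
rewrite /sewing_bound.
have := ler_wpM2l k0 first.
have := ler_wpM2l (mulr_ge0 k0 k0) second.
lra.
Qed.
End SewingStep.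

(** * Sewing along the partition *)

Lemma first_crossing (Q : pred nat) (j n : nat) : (j <= n)%N -> Q j -> ~~ Q n ->
  exists m, [/\ (j <= m < n)%N, Q m & ~~ Q m.+1].
Proof.
move=> jn Qj; elim: n jn => [|n IH]; first by rewrite leqn0 => /eqP <-; rewrite Qj.
rewrite leq_eqVlt => /predU1P[<-|jn]; first by rewrite Qj.
move=> nQ; have [Qn|/IH] := boolP (Q n); first by exists n; rewrite -ltnS jn ltnSn.
by case=> // m [/andP[jm mn] Qm nQm]; exists m; rewrite jm ltnS ltnW.
Qed.

Lemma nodes_le (R : realType) (N : nat) (t : nat -> R) :
  (forall k, (k < N)%N -> t k < t k.+1) ->
  forall j k, (j <= k)%N -> (k <= N)%N -> t j <= t k.
Proof.
move=> t_lt j; elim=> [|k IH]; first by rewrite leqn0 => /eqP ->.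
rewrite leq_eqVlt => /predU1P[-> //|jk kN].
by rewrite (le_trans (IH _ _)) ?ltW ?t_lt // ltnW.
Qed.

Section DiscreteSewing.
Context {R : realType} {V : zmodType}.
Context (nrm : V -> R) (nrm0 : nrm 0 = 0) (nrm_ge0 : forall x, 0 <= nrm x)
  (nrmD : forall x y, nrm (x + y) <= nrm x + nrm y).
Context (N : nat) (t : nat -> R) (t_lt : forall k, (k < N)%N -> t k < t k.+1).
Context (Y : nat -> nat -> V -> V) (x : nat -> V).
Context (Y_id : forall k z, (k <= N)%N -> Y k k z = z)
  (Y_flow : forall i j k z, (i <= j)%N -> (j <= k)%N -> (k <= N)%N ->
     Y i k z = Y j k (Y i j z)).
Context (eps kap A L : R) (heps : 0 < eps < 1 / 2) (kap0 : 0 <= kap) (A0 : 0 <= A)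
  (L0 : 0 <= L).

Local Notation al := (1 / 2 - eps / 3).
Local Notation be := ((1 + eps) / 2).
Local Notation th := (eps / 6).

Context (Y_lip : forall j k z1 z2, (j <= k)%N -> (k <= N)%N ->
     nrm (Y j k z1 - Y j k z2) <= L * nrm (z1 - z2))
  (Y_incr : forall j k z1 z2, (j < k)%N -> (k <= N)%N ->
     nrm ((Y j k z1 - z1) - (Y j k z2 - z2))
       <= kap * (2 `^ th - 1) * (t k - t j) `^ al * nrm (z1 - z2)).

(** The error at node k of the flow restarted from x j at node j. *)
Let err j k := Y j k (x j) - x k.
Let defect j k := \sum_(j <= i < k) err i i.+1.

Context (defect_le : forall j k, (j < k)%N -> (k <= N)%N ->
  nrm (defect j k) <= A * (t k - t j) `^ be).

Let t_le j k : (j <= k)%N -> (k <= N)%N -> t j <= t k.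
Proof. exact: nodes_le. Qed.

Let t_ltn j k : (j < k)%N -> (k <= N)%N -> t j < t k.
Proof.
by move=> jk kN; rewrite (lt_le_trans (t_lt _)) ?t_le // (leq_trans jk).
Qed.

Let gap0 : 0 <= 2 `^ th - 1 :> R.
Proof.
have /andP[? ?] := heps.
by have [] := @pow2_gap R th _ _; [lra|lra|move=> /ltW].
Qed.

Let Y_incr_le j k z1 z2 : (j <= k)%N -> (k <= N)%N ->
  nrm ((Y j k z1 - z1) - (Y j k z2 - z2))
    <= kap * (2 `^ th - 1) * (t k - t j) `^ al * nrm (z1 - z2).
Proof.
rewrite leq_eqVlt => /predU1P[->|jk] kN; last exact: Y_incr.
by rewrite !Y_id // !subrr nrm0 !mulr_ge0 ?powR_ge0.
Qed.

Let defect_le0 j k : (j <= k)%N -> (k <= N)%N ->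
  nrm (defect j k) <= A * (t k - t j) `^ be.
Proof.
rewrite leq_eqVlt => /predU1P[->|jk] kN; last exact: defect_le.
by rewrite /defect big_geq // nrm0 mulr_ge0 ?powR_ge0.
Qed.

(** Composing the flows through node m, the error at m is transported to k; the
first summand is the difference between the transported and the original error,
controlled by the increments of the flow. *)
Lemma err_split j m k : (j <= m)%N -> (m <= k)%N -> (k <= N)%N ->
  err j k = ((Y m k (Y j m (x j)) - Y j m (x j)) - (Y m k (x m) - x m))
            + err j m + err m k.
Proof.
move=> jm mk kN; rewrite {1}/err (Y_flow _ jm mk kN) /err.
move: (Y j m _) (Y m k (x m)) (Y m k (Y j m _)) => b c a.
by rewrite opprB [X in _ = X + _]addrAC !addrA !subrK.
Qed.

(** Strong induction on the number of steps. The interval is cut at node m, the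
last one not past its midpoint, and at node m + 1; the single step in between has
no remainder, and both outer intervals are at most half as long. *)
Lemma sewing j k : (j <= k)%N -> (k <= N)%N ->
  kap * (t k - t j) `^ al <= 2 ->
  nrm (err j k - defect j k) <= A * sewing_bound eps kap (t k - t j).
Proof.
have [n] := ubnP (k - j); elim: n j k => // n IH j k; rewrite ltnS => kjn jk kN kl.
have := jk; rewrite leq_eqVlt => /predU1P[jkE|ltjk].
  rewrite -jkE /err /defect big_geq // Y_id ?jkE // subrr subr0 nrm0.
  by rewrite mulr_ge0 // sewing_bound_ge0.
have tjk := t_ltn ltjk kN.
pose Q m := t m - t j <= (t k - t j) / 2.
have [||m [/andP[jm mk] Qm nQm]] := @first_crossing Q j k jk.
- by rewrite /Q subrr divr_ge0 // subr_ge0 ltW.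
- by rewrite /Q -ltNge; lra.
have tjm := t_le jm (ltnW (leq_trans mk kN)).
have tmm := t_ltn (ltnSn m) (leq_trans mk kN).
have tmk := t_le mk kN.
have mN : (m <= N)%N by rewrite ltnW // (leq_trans mk).
pose a := t m - t j; pose s := t m.+1 - t m; pose b := t k - t m.+1.
have tmk1 := t_le mk kN.
have [a0 s0 b0] : [/\ 0 <= a, 0 <= s & 0 <= b] by rewrite !subr_ge0 (ltW tmm).
have lE : a + b + s = t k - t j by rewrite /a /b /s; ring.
have bsE : b + s = t k - t m by rewrite /b /s; ring.
have a2 : a <= (a + b + s) / 2 by rewrite lE.
have b2 : b <= (a + b + s) / 2.
  by rewrite lE /b; move: nQm; rewrite /Q -ltNge; lra.
have l0 : 0 < a + b + s by rewrite lE subr_gt0.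
have [eps0 eps2] := andP heps.
have small y : 0 <= y -> y <= t k - t j -> kap * y `^ al <= 2.
  by move=> y0 yl; rewrite (le_trans _ kl) // ler_wpM2l // powR_mono //; lra.
have IH1 : nrm (err j m - defect j m) <= A * sewing_bound eps kap a.
  apply: IH => //; first by rewrite (leq_trans _ kjn) // ltn_sub2r.
  by apply: small => //; rewrite -lE; lra.
have IH2 : nrm (err m.+1 k - defect m.+1 k) <= A * sewing_bound eps kap b.
  apply: IH => //; first by rewrite (leq_trans _ kjn) // ltn_sub2l // ltnS.
  by apply: small => //; rewrite -lE; lra.
have err_m : nrm (err j m) <= A * (a `^ be + sewing_bound eps kap a).
  rewrite -[err j m](subrK (defect j m)) (le_trans (nrmD _ _)) // mulrDr addrC.
  by rewrite lerD // defect_le0.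
have err_step : nrm (err m m.+1) <= A * s `^ be.
  by have := defect_le0 (leqnSn m) (leq_trans mk kN); rewrite /defect big_nat1.
have splitE := err_split jm (ltnW mk) kN.
have splitE' := err_split (leqnSn m) mk kN.
have r1 := Y_incr_le (Y j m (x j)) (x m) (ltnW mk) kN.
have r2 := Y_incr_le (Y m m.+1 (x m)) (x m.+1) mk kN.
have dE : defect j k = defect j m + (err m m.+1 + defect m.+1 k).
  by rewrite /defect (big_cat_nat jm (ltnW mk)) /= (big_ltn mk).
rewrite splitE splitE' dE.
move: r1 r2; rewrite -/(err j m) -/(err m m.+1).
move: (Y m k (Y j m _) - _ - _) (Y m.+1 k (Y m m.+1 _) - _ - _) => r1 r2 Hr1 Hr2.
(* r1 and r2 are the two defects of additivity, at m and at m + 1. *)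
have -> : r1 + err j m + (r2 + err m m.+1 + err m.+1 k)
    - (defect j m + (err m m.+1 + defect m.+1 k))
  = (err j m - defect j m) + (err m.+1 k - defect m.+1 k) + (r1 + r2).
  move: (err j m) (err m m.+1) (err m.+1 k) (defect j m) (defect m.+1 k) => ? ? ? ? ?.
  rewrite !opprD !addrA [LHS](ACl ((2*6)*(5*8)*(1*3)*(4*7)))/= subrr addr0.
  by rewrite !addrA.
apply: (le_trans (nrmD _ _)); apply: (le_trans (lerD (nrmD _ _) (nrmD _ _))).
apply: (le_trans (lerD (lerD IH1 IH2) (lerD Hr1 Hr2))).
rewrite -bsE -/b -lE.
have lE_le : a + b + s <= t k - t j by rewrite lE.
have step := sewing_step heps kap0 a0 b0 s0 l0 a2 b2 (small _ (ltW l0) lE_le).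
apply: le_trans (ler_wpM2l A0 step).
have k1 : 0 <= kap * (2 `^ th - 1) * (b + s) `^ al.
  by rewrite !mulr_ge0 ?powR_ge0.
have k2 : 0 <= kap * (2 `^ th - 1) * b `^ al.
  by rewrite !mulr_ge0 ?powR_ge0.
have := ler_wpM2l k1 err_m; have := ler_wpM2l k2 err_step.
lra.
Qed.

Lemma step_le m : (m < N)%N -> nrm (err m m.+1) <= A * (t m.+1 - t m) `^ be.
Proof. by move=> mN; have := defect_le (ltnSn m) mN; rewrite /defect big_nat1. Qed.

Lemma err_le_small j k : (j <= k)%N -> (k <= N)%N ->
  kap * (t k - t j) `^ al <= 2 ->
  nrm (err j k) <= A * ((t k - t j) `^ be + kap * (t k - t j) `^ (1 + th)).
Proof.
move=> jk kN kl; rewrite -[err j k](subrK (defect j k)) (le_trans (nrmD _ _)) //.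
rewrite mulrDr addrC lerD ?defect_le0 // (le_trans (sewing jk kN kl)) //.
by rewrite ler_wpM2l // sewing_bound_le.
Qed.

(** Each block runs from the current node to the first node m + 1 at which
kap l^al exceeds 2, so that [sewing] still applies up to m and the last step of
the block is a single local error. The flow from the block to k costs a factor
L, whereas the error of the remaining nodes m + 1, ..., k enters with factor 1:
no power of L is accumulated. The last, incomplete block is responsible for the
term with exponent be. *)
Lemma err_le j k : (j <= k)%N -> (k <= N)%N ->
  nrm (err j k) <= A * ((t k - t 0%N) `^ be
                        + 2 * kap * (L + 1) * (t k - t 0%N) `^ th * (t k - t j)).
Proof.
have [n] := ubnP (k - j); elim: n j => // n IH j; rewrite ltnS => kjn jk kN.
have [eps0 eps2] := andP heps.
have ge0L := L0; have ge0A := A0; have ge0k := kap0.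
have t0j : t 0%N <= t j by rewrite t_le // (leq_trans jk).
have tjk := t_le jk kN.
have powth y : 0 <= y -> y `^ (1 + th) = y `^ th * y.
  by move=> y0; rewrite powR_add ?powRr1 1?mulrC //; lra.
pose D := (t k - t 0%N) `^ th.
have D0 : 0 <= D by exact: powR_ge0.
have powD y : 0 <= y -> y <= t k - t 0%N -> kap * y `^ (1 + th) <= kap * D * y.
  move=> y0 yt; rewrite powth // mulrA ler_wpM2r // ler_wpM2l // powR_mono //; lra.
have [kl|kl] := leP (kap * (t k - t j) `^ al) 2.
  rewrite (le_trans (err_le_small jk kN kl)) // ler_wpM2l // lerD //.
    by rewrite powR_mono //; lra.
  have [l0 lt0] : 0 <= t k - t j /\ t k - t j <= t k - t 0%N by split; lra.
  apply: (le_trans (powD _ l0 lt0)); rewrite -/D ler_wpM2r // ler_wpM2r //.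
  by have := mulr_ge0 ge0k ge0L; lra.
pose Q m := kap * (t m - t j) `^ al <= 2.
have [||m [/andP[jm mk] Qm nQm]] := @first_crossing Q j k jk.
- by rewrite /Q subrr powR0 ?mulr0 // gt_eqF //; lra.
- by rewrite /Q -ltNge.
have mN := leq_trans mk kN.
have tjm := t_le jm (ltnW mN).
have tmm := t_ltn (ltnSn m) mN.
have tmk := t_le mk kN.
pose l := t m.+1 - t j.
have l0 : 0 <= l by rewrite /l; lra.
have large : 2 < kap * l `^ al by rewrite ltNge.
have err_m := err_le_small jm (ltnW mN) Qm.
have err_step := step_le mN.
have -> : err j k = (Y m k (Y j m (x j)) - Y m k (x m))
    + (Y m.+1 k (Y m m.+1 (x m)) - Y m.+1 k (x m.+1)) + err m.+1 k.
  rewrite -(Y_flow _ (leqnSn m) mk kN) -(Y_flow _ jm (ltnW mk) kN) /err.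
  by rewrite !addrA !subrK.
apply: (le_trans (nrmD _ _)); apply: (le_trans (lerD (nrmD _ _) (lexx _))).
have lip1 := Y_lip (Y j m (x j)) (x m) (ltnW mk) kN.
have lip2 := Y_lip (Y m m.+1 (x m)) (x m.+1) mk kN.
(* Here kap l^al > 2 turns the two powers l^be into kap l^(1 + th). *)
have block : (t m - t j) `^ be + kap * (t m - t j) `^ (1 + th)
             + (t m.+1 - t m) `^ be <= 2 * (kap * D * l).
  apply: (@le_trans _ _ (2 * (kap * l `^ (1 + th)))); last first.
    by rewrite ler_pM2l // powD // /l; lra.
  have -> : 1 + th = al + be by lra.
  have p1 : (t m - t j) `^ be <= l `^ be by rewrite powR_mono // /l; lra.
  have p2 : (t m.+1 - t m) `^ be <= l `^ be by rewrite powR_mono // /l; lra.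
  have p3 : (t m - t j) `^ (al + be) <= l `^ (al + be).
    by rewrite powR_mono // /l; lra.
  have := ler_wpM2l ge0k p3.
  have := ler_wpM2r (powR_ge0 l be) (ltW large).
  rewrite -mulrA -powR_add; [|lra|lra].
  lra.
have IHm : nrm (err m.+1 k) <= A * ((t k - t 0%N) `^ be
              + 2 * kap * (L + 1) * D * (t k - t m.+1)).
  apply: IH => //; rewrite (leq_trans _ kjn) // ltn_sub2l ?ltnS //.
  exact: leq_ltn_trans jm mk.
have LA : L * (nrm (err j m) + nrm (err m m.+1)) <= L * A * (2 * (kap * D * l)).
  rewrite -mulrA ler_wpM2l // (le_trans (lerD err_m err_step)) //.
  by rewrite -mulrDr ler_wpM2l.
have AkD : 0 <= A * (kap * D * l) by rewrite !mulr_ge0.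
move: lip1 lip2 IHm LA AkD; rewrite -/(err j m) -/(err m m.+1) -/D /l.
lra.
Qed.

End DiscreteSewing.

(** * The Euclidean norm *)

Section EuclideanNorm.
Context {R : realType} {d : nat}.
Implicit Types x y : 'rV[R]_d.

Let ssq_ge0 x : 0 <= \sum_(i < d) x 0 i ^+ 2.
Proof. by apply: sumr_ge0 => i _; exact: sqr_ge0. Qed.

Lemma enorm_ge0 x : 0 <= enorm x.
Proof. exact: sqrtr_ge0. Qed.

Lemma enorm_sqr x : enorm x ^+ 2 = \sum_(i < d) x 0 i ^+ 2.
Proof. by rewrite sqr_sqrtr. Qed.

Lemma enorm0 : enorm (0 : 'rV[R]_d) = 0.
Proof.
rewrite /enorm big1 ?sqrtr0 // => i _.
by rewrite mxE expr0n.
Qed.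

Lemma enorm_eq0 x : enorm x = 0 -> x = 0.
Proof.
move=> x0; have := enorm_sqr x; rewrite x0 expr0n /= => /esym/eqP.
rewrite psumr_eq0 => [/allP h|i _]; last exact: sqr_ge0.
apply/rowP => i; rewrite mxE; apply/eqP.
by have := h i (mem_index_enum i); rewrite /= sqrf_eq0.
Qed.

Lemma enorm_opp x : enorm (- x) = enorm x.
Proof. by rewrite /enorm; under eq_bigr do rewrite mxE sqrrN. Qed.

Lemma cauchy_schwarz x y : \sum_(i < d) x 0 i * y 0 i <= enorm x * enorm y.
Proof.
have [/enorm_eq0 ->|x0] := eqVneq (enorm x) 0.
  by rewrite enorm0 mul0r big1 // => i _; rewrite mxE mul0r.
have [/enorm_eq0 ->|y0] := eqVneq (enorm y) 0.
  by rewrite enorm0 mulr0 big1 // => i _; rewrite mxE mulr0.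
have xy0 : 0 < enorm x * enorm y by rewrite mulr_gt0 // lt0r ?x0 ?y0 enorm_ge0.
rewrite -(ler_pM2l xy0).
have : 0 <= \sum_(i < d) (enorm y * x 0 i - enorm x * y 0 i) ^+ 2.
  by apply: sumr_ge0 => i _; exact: sqr_ge0.
have -> : \sum_(i < d) (enorm y * x 0 i - enorm x * y 0 i) ^+ 2
    = enorm y ^+ 2 * (\sum_(i < d) x 0 i ^+ 2)
      + enorm x ^+ 2 * (\sum_(i < d) y 0 i ^+ 2)
      - 2 * (enorm x * enorm y) * \sum_(i < d) x 0 i * y 0 i.
  rewrite !mulr_sumr -big_split -sumrB; apply: eq_bigr => i _ /=; ring.
by rewrite -!enorm_sqr; lra.
Qed.

Lemma enormD x y : enorm (x + y) <= enorm x + enorm y.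
Proof.
rewrite -(@ler_pXn2r _ 2) // ?nnegrE ?addr_ge0 ?enorm_ge0 //.
have -> : enorm (x + y) ^+ 2
    = enorm x ^+ 2 + enorm y ^+ 2 + 2 * \sum_(i < d) x 0 i * y 0 i.
  rewrite !enorm_sqr mulr_sumr -!big_split; apply: eq_bigr => i _ /=.
  by rewrite mxE; ring.
by have := cauchy_schwarz x y; rewrite sqrrD; lra.
Qed.
End EuclideanNorm.

(** * Extending identities from a grid by continuity *)

Section Continuity.
Context {R : realType}.

(** Rounding down keeps the order of the times and never leaves [0, T]. *)
Definition grid (n : nat) (x : R) : R := (Num.floor (x * n.+1%:R))%:~R / n.+1%:R.

Lemma grid_le n x : grid n x <= x.
Proof. by rewrite ler_pdivrMr ?ltr0n // floor_le. Qed.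

Lemma grid_gt n x : x - n.+1%:R^-1 < grid n x.
Proof.
rewrite ltr_pdivlMr ?ltr0n // mulrBl mulVf ?pnatr_eq0 //.
by rewrite ltrBlDr -[X in _ + X]/(1%:~R) -intrD floorD1_gt.
Qed.

Lemma grid_mono n x y : x <= y -> grid n x <= grid n y.
Proof.
move=> xy; rewrite ler_pM2r ?invr_gt0 ?ltr0n // ler_int.
by apply: le_floor; rewrite ler_wpM2r.
Qed.

Lemma grid_ge0 n x : 0 <= x -> 0 <= grid n x.
Proof.
by move=> x0; rewrite divr_ge0 // ler0z floor_ge0 mulr_ge0.
Qed.

Lemma grid_cvg x : grid n x @[n --> \oo] --> x.
Proof.
apply: (@squeeze_cvgr _ _ _ _ (fun n => x - harmonic n) (cst x)).
- by apply: nearW => n /=; rewrite grid_le (ltW (grid_gt _ _)).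
- by rewrite -[X in _ --> X]subr0; apply: cvgB; [exact: cvg_cst|exact: cvg_harmonic].
- exact: cvg_cst.
Qed.

Definition vgrid d (n : nat) (z : 'rV[R]_d) : 'rV[R]_d := map_mx (grid n) z.

Lemma vgrid_cvg d (z : 'rV[R]_d) : vgrid n z @[n --> \oo] --> z.
Proof.
apply/cvg_ballP => e e0.
have := @cvg_harmonic R => /cvgrPdist_lt /(_ e e0); apply: filterS => n.
rewrite sub0r normrN ger0_norm ?harmonic_ge0 // => ne; split=> // i j.
rewrite mxE /ball /= ger0_norm ?subr_ge0 ?grid_le //.
by rewrite ltrBlDr -ltrBlDl (lt_trans _ (grid_gt _ _)) // ltrD2l ltrN2.
Qed.

Lemma within_cvg_seq {T U : topologicalType} (D : set T) (f : T -> U)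
    (u : nat -> T) (p : T) : {within D, continuous f} -> D p -> (forall n, D (u n)) ->
  u n @[n --> \oo] --> p -> f (u n) @[n --> \oo] --> f p.
Proof.
move=> /subspace_continuousP fD Dp Du up.
apply: cvg_comp (fD p Dp) => P; rewrite /within /= => DP.
have := up _ DP; rewrite !nbhs_simpl /=.
by apply: filterS => n /(_ (Du n)).
Qed.

(** Only r, s and z are rounded; t is kept, as rounding down preserves s <= t. *)
Lemma flow_closure d (T : R) (f : R -> R -> 'rV[R]_d -> 'rV[R]_d) :
  {within [set p : R * R * 'rV[R]_d | 0 <= p.1.2 /\ p.1.2 <= p.1.1 /\ p.1.1 <= T],
     continuous (fun p : R * R * 'rV[R]_d => f p.1.1 p.1.2 p.2)} ->
  (forall n r s z t, 0 <= grid n r -> grid n r <= grid n s -> grid n s <= t -> t <= T ->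
     f t (grid n s) (f (grid n s) (grid n r) (vgrid n z)) = f t (grid n r) (vgrid n z)) ->
  (forall n s z, 0 <= grid n s <= T -> f (grid n s) (grid n s) (vgrid n z) = vgrid n z) ->
  (forall r s t z, 0 <= r -> r <= s -> s <= t -> t <= T -> f t s (f s r z) = f t r z) /\
  (forall s z, 0 <= s <= T -> f s s z = z).
Proof.
move=> fc flow_grid id_grid.
have fcvg (a b : nat -> R) (v : nat -> 'rV[R]_d) (a0 b0 : R) (v0 : 'rV[R]_d) :
    (forall n, [/\ 0 <= b n, b n <= a n & a n <= T]) -> 0 <= b0 -> b0 <= a0 -> a0 <= T ->
    a n @[n --> \oo] --> a0 -> b n @[n --> \oo] --> b0 -> v n @[n --> \oo] --> v0 ->
    f (a n) (b n) (v n) @[n --> \oo] --> f a0 b0 v0.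
  move=> H b0_ge0 ba aT acv bcv vcv.
  apply: (within_cvg_seq (u := fun n => ((a n, b n), v n)) (p := ((a0, b0), v0)) fc).
  - by [].
  - by move=> n /=; have [] := H n.
  - exact: (cvg_pair (cvg_pair acv bcv) vcv).
have gle n r s : r <= s -> grid n r <= s by exact/le_trans/grid_le.
have uniq (u : nat -> 'rV[R]_d) (l l' : 'rV[R]_d) :
    u n @[n --> \oo] --> l -> u n @[n --> \oo] --> l' -> l = l'.
  exact: norm_cvg_unique.
split=> [r s t z r0 rs st tT|s z /andP[s0 sT]].
- have s0 := le_trans r0 rs; have sT := le_trans st tT; have rt := le_trans rs st.
  have inner : f (grid n s) (grid n r) (vgrid n z) @[n --> \oo] --> f s r z.
    apply: fcvg => //; [|exact: grid_cvg|exact: grid_cvg|exact: vgrid_cvg].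
    by move=> n; rewrite grid_ge0 // grid_mono // gle.
  have outer : f t (grid n s) (f (grid n s) (grid n r) (vgrid n z))
      @[n --> \oo] --> f t s (f s r z).
    apply: (fcvg (cst t)) => //; [|exact: cvg_cst|exact: grid_cvg].
    by move=> n; rewrite grid_ge0 // gle.
  apply: (uniq _ _ _ outer).
  have -> : (fun n => f t (grid n s) (f (grid n s) (grid n r) (vgrid n z)))
      = (fun n => f t (grid n r) (vgrid n z)).
    by apply/funext => n; rewrite flow_grid ?grid_ge0 ?grid_mono ?gle.
  apply: (fcvg (cst t)) => //; [|exact: cvg_cst|exact: grid_cvg|exact: vgrid_cvg].
  by move=> n; rewrite grid_ge0 // gle.
- apply: (uniq _ _ _ _ (@vgrid_cvg d z)).
  have <- : (fun n => f (grid n s) (grid n s) (vgrid n z)) = (fun n => vgrid n z).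
    by apply/funext => n; rewrite id_grid // grid_ge0 // gle.
  apply: fcvg => //; [|exact: grid_cvg|exact: grid_cvg|exact: vgrid_cvg].
  by move=> n; split; rewrite ?grid_ge0 ?lexx ?gle.
Qed.
End Continuity.

(** * The flow property at all times and points *)

Section Flow.
Context {R : realType} {disp : measure_display} {Omega : measurableType disp}.
Context {P : probability Omega R}.

Lemma ae_forall_countable (I : countType) (Q : I -> Omega -> Prop) :
  (forall i, {ae P, forall w, Q i w}) -> {ae P, forall w, forall i, Q i w}.
Proof.
move=> aeQ.
have : {ae P, forall w, forall n : nat, if unpickle n is Some i then Q i w else True}.
  apply: ae_foralln => n; case: (unpickle n) => [i|]; first exact: aeQ.
  exact: nearW.
by apply: filterS => w Qw i; have := Qw (pickle i); rewrite pickleK.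
Qed.

Lemma vmeasurable_cst (G : set (set Omega)) d (z : 'rV[R]_d) :
  sigma_algebra setT G -> vmeasurable_wrt G (fun _ => z).
Proof.
move=> [G0 GC _] i B mB; rewrite preimage_cst; case: ifPn => // _.
by rewrite -(setD0 setT); exact: GC.
Qed.

Context {T : R} {F : R -> set (set Omega)} (hF : filtration T F) {m d : nat}
  {W : 'I_m -> R -> Omega -> R}
  {g0 : 'rV[R]_d -> 'rV[R]_d} {g : 'I_m -> 'rV[R]_d -> 'rV[R]_d}.

Lemma sde_solution_restrict (s s' : R) (X : R -> Omega -> 'rV[R]_d) : s <= s' ->
  sde_solution P T F W g0 g s X -> sde_solution P T F W g0 g s' X.
Proof.
move=> ss' [Xm Xc Xi Xe]; split.
- by move=> t /andP[st tT]; apply: Xm; rewrite (le_trans ss').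
- apply: filterS Xc => w; apply: continuous_subspaceW.
  by move=> u /=; rewrite !in_itv /= => /andP[su ->]; rewrite (le_trans ss').
- apply: filterS Xi => w Xi i; apply: integrableS (Xi i) => //.
  by move=> u /=; rewrite !in_itv /= => /andP[su ->]; rewrite (le_trans ss').
- by move=> r t i sr rt tT; apply: Xe => //; exact: le_trans sr.
Qed.

Context {y : Omega -> R -> R -> 'rV[R]_d -> 'rV[R]_d}
  (huniq : pathwise_unique P T F W g0 g)
  (hy : solution_map P T F W g0 g y).

(** y(.;r,z) restricted to [s, T] and y(.;s,y(s;r,z)) solve the same equation
with the same value at time s. *)
Lemma flow_fixed (r s : R) (z : 'rV[R]_d) : 0 <= r -> r <= s -> s <= T ->
  {ae P, forall w, (forall t, s <= t <= T -> y w t s (y w s r z) = y w t r z)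
                   /\ y w s s z = z}.
Proof.
move=> r0 rs sT; have [sol _] := hy; have [Fsig _] := hF.
have rT : 0 <= r <= T by rewrite r0 (le_trans rs).
have sT' : 0 <= s <= T by rewrite sT (le_trans r0).
have [Xsol _] := sol r (fun _ => z) rT (vmeasurable_cst z (Fsig _ rT).1).
have [_ id_s] := sol s (fun _ => z) sT' (vmeasurable_cst z (Fsig _ sT').1).
have [Xm _ _ _] := Xsol.
have [|X'sol id_X] := sol s (fun w => y w s r z) sT' (Xm s _); first by rewrite rs.
have uniq := huniq sT' X'sol (sde_solution_restrict rs Xsol) id_X.
by apply: filterS (filterI uniq id_s) => w [].
Qed.

Lemma flow_ae : {ae P, forall w,
  (forall r s t z, 0 <= r -> r <= s -> s <= t -> t <= T ->
     y w t s (y w s r z) = y w t r z) /\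
  (forall s z, 0 <= s <= T -> y w s s z = z)}.
Proof.
have [_ yc] := hy.
pose node (n : nat) (a : int) : R := a%:~R / n.+1%:R.
(* A mesh index, the two integers that locate r and s, and those that locate z. *)
have : {ae P, forall w, forall i : nat * int * int * 'rV[int]_d,
    let r := node i.1.1.1 i.1.1.2 in let s := node i.1.1.1 i.1.2 in
    let z := map_mx (node i.1.1.1) i.2 in
    0 <= r -> r <= s -> s <= T ->
    (forall t, s <= t <= T -> y w t s (y w s r z) = y w t r z) /\ y w s s z = z}.
  apply: ae_forall_countable => -[[[n a] b] v] /=.
  have [r0|/negP nr] := boolP (0 <= node n a); last by apply: nearW.
  have [rs|/negP nr] := boolP (node n a <= node n b); last by apply: nearW.
  have [sT|/negP nr] := boolP (node n b <= T); last by apply: nearW.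
  by have := flow_fixed (map_mx (node n) v) r0 rs sT; apply: filterS.
have vgridE n (z : 'rV[R]_d) :
    vgrid n z = map_mx (node n) (map_mx (fun x => Num.floor (x * n.+1%:R)) z).
  by apply/rowP => i; rewrite !mxE.
move=> flow; apply: filterS (filterI yc flow) => w [ycw fl].
apply: (flow_closure ycw) => [n r s z t r0 rs st tT|n s z /andP[s0 sT]];
  rewrite vgridE.
  have := fl (n, Num.floor (r * n.+1%:R), Num.floor (s * n.+1%:R),
    map_mx (fun x => Num.floor (x * n.+1%:R)) z) r0 rs (le_trans st tT).
  by case=> + _; apply; rewrite st.
have := fl (n, Num.floor (s * n.+1%:R), Num.floor (s * n.+1%:R),
    map_mx (fun x => Num.floor (x * n.+1%:R)) z) s0 (lexx _) sT.
by case.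
Qed.
End Flow.

(** * The global error *)

Lemma compose_stepsS (Omega V : Type) (S : nat -> V -> Omega -> V) n z w :
  compose_steps S 0 n.+1 z w = S n (compose_steps S 0 n z w) w.
Proof. by rewrite /compose_steps /index_iota !subn0 -addn1 iotaD foldl_cat. Qed.

(** With p = 2^(eps/6), the prefactor 2K(L+2)/(1 - 1/p) equals
2 (K/(p-1)) (L+2) p, hence dominates 2 (K/(p-1)) (L+1). *)
Lemma LSDE_const_ge (R : realType) (eps T L K : R) : 0 < eps < 1 / 2 -> 0 < T ->
  0 <= L -> 0 <= K ->
  T `^ ((1 + eps) / 2)
    + 2 * (K / (2 `^ (eps / 6) - 1)) * (L + 1) * T `^ (1 + eps / 6)
  <= LSDE_const eps T L K.
Proof.
move=> /andP[eps0 eps2] T0 L0 K0; rewrite /LSDE_const lerD2l.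
have [q0 _] : 0 < 2 `^ (eps / 6) - 1 :> R /\ 2 `^ (eps / 6) - 1 <= 3 / 50 :> R.
  by apply: pow2_gap; lra.
rewrite powRN; set p : R := 2 `^ (eps / 6) in q0 *.
have pn0 : p != 0 by rewrite gt_eqF //; lra.
have qn0 : p - 1 != 0 by rewrite gt_eqF.
have -> : 2 * K * (L + 2) / (1 - p^-1) = 2 * (K / (p - 1)) * (L + 2) * p.
  by field; rewrite qn0.
have k0 : 0 <= K / (p - 1) by rewrite divr_ge0 // ltW.
apply: ler_pM; rewrite ?powR_ge0 ?mulr_ge0 ?addr_ge0 ?invr_ge0 ?(ltW q0) //.
  have Lp : 0 <= (L + 2) * p - (L + 1) by have := mulr_ge0 L0 (ltW q0); lra.
  by have := mulr_ge0 k0 Lp; lra.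
by rewrite lerDl divr_ge0 ?mulr_ge0 ?powR_ge0.
Qed.

Unset Implicit Arguments.
Set Strict Implicit.

Theorem mainTheorem1 (R : realType) (disp : measure_display)
    (Omega : measurableType disp) (P : probability Omega R)
    (T : R) (hT : 0 < T)
    (F : R -> set (set Omega)) (hF : filtration T F)
    (m d : nat) (W : 'I_m -> R -> Omega -> R)
    (hW : forall j, brownian P T F (W j)) (hWind : independent_processes P T W)
    (g0 : 'rV[R]_d -> 'rV[R]_d) (g : 'I_m -> 'rV[R]_d -> 'rV[R]_d)
    (hg0 : borel_fun g0) (hg : forall j, borel_fun (g j))
    (huniq : pathwise_unique P T F W g0 g)
    (y : Omega -> R -> R -> 'rV[R]_d -> 'rV[R]_d)
    (hy : solution_map P T F W g0 g y)
    (eps : R) (heps : 0 < eps < 1 / 2) (gamma : R) (y0 : 'rV[R]_d)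
    (N : nat) (tau : nat -> {RV P >-> R}) (htau : random_partition P T N tau)
    (S : nat -> 'rV[R]_d -> Omega -> 'rV[R]_d)
    (hS : forall n z, vmeasurable_wrt (@measurable _ Omega) (S n z))
    (L K KT : {RV P >-> R})
    (hL : {ae P, forall w, 0 < L w /\
       forall (s t : R) (z1 z2 : 'rV[R]_d), 0 <= s -> s <= t -> t <= T ->
         enorm (y w t s z1 - y w t s z2) <= L w * enorm (z1 - z2)})
    (hK : {ae P, forall w, 0 < K w /\
       forall (s t : R) (z1 z2 : 'rV[R]_d), 0 <= s -> s < t -> t <= T ->
         enorm ((y w t s z1 - z1) - (y w t s z2 - z2))
           <= K w * (t - s) `^ (1 / 2 - eps / 3) * enorm (z1 - z2)})
    (hKT : {ae P, forall w, 0 < KT w /\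
       forall k n : nat, (k < n)%N -> (n <= N)%N ->
         enorm (\sum_(k <= j < n) local_error y S tau j (compose_steps S 0 j y0 w) w)
           <= KT w * (tau n w - tau k w) `^ ((1 + eps) / 2)
              * mesh N tau w `^ (gamma - eps)}) :
  {ae P, forall w,
     \big[Num.max/0]_(n < N.+1)
        enorm (compose_steps S 0 n y0 w - y w (tau n w) 0 y0)
       <= KT w * LSDE_const eps T (L w) (K w) * mesh N tau w `^ (gamma - eps)}.
Proof.
have flow := flow_ae hF huniq hy.
apply: filterS (filterI flow (filterI htau (filterI hL (filterI hK hKT)))).
move=> w [[flow_w id_w]] [[tau0 tauN tau_lt tau_in]] [[L0 lip]] [[K0 incr]] [KT0 defect].
have [eps0 eps2] := andP heps.
pose A := KT w * mesh N tau w `^ (gamma - eps).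
have A0 : 0 <= A by rewrite mulr_ge0 ?powR_ge0 // ltW.
have [q0 _] : 0 < 2 `^ (eps / 6) - 1 :> R /\ 2 `^ (eps / 6) - 1 <= 3 / 50 :> R.
  by apply: pow2_gap; lra.
have [kap kapD] : exists kap, kap = K w / (2 `^ (eps / 6) - 1) by eexists.
have kap0 : 0 <= kap by rewrite kapD divr_ge0 // ltW.
have kapE : kap * (2 `^ (eps / 6) - 1) = K w by rewrite kapD divfK // gt_eqF.
pose t k := tau k w; pose x k := compose_steps S 0 k y0 w.
have tin k : (k <= N)%N -> 0 <= t k /\ t k <= T by move=> /tau_in /andP.
have t_le := nodes_le (t := t) tau_lt.
have ErrBound n : (n <= N)%N ->
    enorm (y w (t n) (t 0%N) (x 0%N) - x n)
    <= A * ((t n - t 0%N) `^ ((1 + eps) / 2)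
            + 2 * kap * (L w + 1) * (t n - t 0%N) `^ (eps / 6) * (t n - t 0%N)).
  move=> nN.
  apply: (@err_le R 'rV[R]_d (@enorm R d) enorm0 enorm_ge0 enormD N t tau_lt
    (fun j k => y w (t k) (t j)) x _ _ eps kap A (L w)) => //.
  - by move=> k z kN; rewrite id_w // tau_in.
  - move=> i j k z ij jk kN; rewrite flow_w ?t_le //.
    + by have [] := tin i (leq_trans ij (leq_trans jk kN)).
    + exact: leq_trans kN.
    + by have [] := tin k kN.
  - exact: ltW.
  - move=> j k z1 z2 jk kN; apply: lip; rewrite ?t_le //.
    + by have [] := tin j (leq_trans jk kN).
    + by have [] := tin k kN.
  - move=> j k z1 z2 jk kN; rewrite kapE; apply: incr.
    + by have [] := tin j (leq_trans (ltnW jk) kN).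
    + by rewrite (lt_le_trans (tau_lt _ (leq_trans jk kN))) ?t_le.
    + by have [] := tin k kN.
  - move=> j k jk kN; rewrite /A mulrAC (le_trans _ (defect j k jk kN)) //.
    rewrite /local_error /x; under [X in enorm X <= _]eq_bigr do rewrite compose_stepsS.
    by [].
have L1 : 0 <= L w + 1 by rewrite addr_ge0 // ltW.
rewrite mulrAC -/A; apply: bigmax_le => [|n _].
  rewrite mulr_ge0 //.
  apply: le_trans (LSDE_const_ge heps hT (ltW L0) (ltW K0)).
  by rewrite -kapD addr_ge0 ?powR_ge0 // !mulr_ge0 ?powR_ge0.
rewrite -enorm_opp opprB -[X in y w _ X]tau0 -[X in y w _ _ X]/(x 0%N).
apply: (le_trans (ErrBound n _)); first by rewrite -ltnS.
rewrite ler_wpM2l // (le_trans _ (LSDE_const_ge heps hT (ltW L0) (ltW K0))) //.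
have [tn0 tnT] := tin n (ltn_ord n).
rewrite -[t 0%N]/(tau 0%N w) tau0 subr0 lerD //; first by rewrite powR_mono //; lra.
rewrite -kapD powR_add ?powRr1 //; [|exact: ltW|lra].
rewrite [T * _]mulrC mulrA; apply: ler_pM => //.
  by rewrite !mulr_ge0 ?powR_ge0.
by rewrite ler_wpM2l ?mulr_ge0 // powR_mono //; lra.
Qed.
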